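(* For $n\ge1$, consider the Kentucky-2 legal decompositions of all integers $m\in[0,a_{2n+1})$; for a decomposition $m=a_{\ell_1}+\cdots+a_{\ell_k}$ with $\ell_1<\cdots<\ell_k$ its gaps are the numbers $\ell_2-\ell_1,\dots,\ell_k-\ell_{k-1}$ (counted with multiplicity). Let $P_n(g)$ be the fraction, among all gaps arising from all these decompositions, of gaps equal to $g$. Then $P(g):=\lim_{n\to\infty}P_n(g)$ exists for every $g\ge0$, with $P(0)=P(1)=P(2)=0$, $P(3)=1/8$, and for $g\ge4$, \[ P(g)=\begin{cases}2^{-j} & \text{if } g=2j,\\ \tfrac34\,2^{-j} & \text{if } g=2j+1.\end{cases} \]
   Context: The Kentucky-2 sequence $(a_n)_{n\ge1}$: index $\ell$ belongs to bin $\lceil \ell/2\rceil$. A legal decomposition of $m\ge0$ using $\{a_1,\dots,a_N\}$ is $m=a_{\ell_1}+\cdots+a_{\ell_k}$, $k\ge0$, $1\le\ell_1<\cdots<\ell_k\le N$, with $\lceil \ell_{j+1}/2\rceil-\lceil \ell_j/2\rceil\ge2$ for all $j$. The sequence is defined by $a_1=1$ and, for $N\ge1$, $a_{N+1}$ is the smallest positive integer with no legal decomposition using $\{a_1,\dots,a_N\}$ (first terms $1,2,3,4,5,8,11,16,\dots$). Every nonnegative integer has a unique legal decomposition. *)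

(* Defs.v *)
From HB Require Import structures.
From mathcomp Require Import all_boot all_order all_algebra.
From mathcomp Require Import all_classical all_reals all_analysis.
Set Implicit Arguments.
Unset Strict Implicit.
Unset Printing Implicit Defensive.
Import Order.TTheory GRing.Theory Num.Theory.
Import numFieldNormedType.Exports.
Local Open Scope nat_scope.

(* [uphalf l] is the ceiling of l / 2. *)
Definition bin (l : nat) : nat := uphalf l.

Definition legal (ls : seq nat) : bool :=
  all (fun l => 1 <= l) ls &&
  sorted (fun i j => (i < j) && (bin i + 2 <= bin j)) ls.

Definition legal_decomp (a : nat -> nat) (m : nat) (ls : seq nat) : bool :=
  legal ls && (\sum_(l <- ls) a l == m).

Definition decomposable (a : nat -> nat) (N m : nat) : Prop :=
  exists ls, legal_decomp a m ls && all (fun l => l <= N) ls.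

Definition undecomposable (a : nat -> nat) (N : nat) : pred nat :=
  fun m => (0 < m) && ~~ `[< decomposable a N m >].

Lemma undecomposable_ex a N : exists m, undecomposable a N m.
Proof.
exists (\sum_(0 <= l < N.+1) a l).+1; apply/andP; split=> //.
apply/asboolPn => -[ls /andP[/andP[/andP[_ s_ls] /eqP sum_ls] ub_ls]].
have: \sum_(l <- ls) a l <= \sum_(0 <= l < N.+1) a l.
  have s_lt : sorted ltn ls by apply: sub_sorted s_ls => i j /andP[].
  have defls : ls = [seq x <- index_iota 0 N.+1 | x \in ls].
    apply: (irr_sorted_eq ltn_trans ltnn) => //.
      exact/sorted_filter/iota_ltn_sorted/ltn_trans.
    move=> x; rewrite mem_filter mem_index_iota /= ltnS.
    by case xls: (x \in ls) => //=; rewrite (allP ub_ls).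
  rewrite [X in \sum_(l <- X) _ <= _]defls big_filter big_mkcond.
  by apply: leq_sum => l _; case: ifP.
by rewrite sum_ls ltnn.
Qed.

Definition least_undecomposable (a : nat -> nat) (N : nat) : nat :=
  ex_minn (undecomposable_ex a N).

(* The function with values a_1, ..., a_N on 1, ..., N and 0 elsewhere. *)
Fixpoint kentucky2_upto (N : nat) : nat -> nat :=
  match N with
  | 0 => fun=> 0
  | 1 => fun l => if l == 1 then 1 else 0
  | N'.+1 => fun l => if l == N'.+1
                      then least_undecomposable (kentucky2_upto N') N'
                      else kentucky2_upto N' l
  end.

(* Only the values at l >= 1 are meaningful. *)
Definition kentucky2 (l : nat) : nat := kentucky2_upto l l.

Lemma kentucky2_uptoE N l : l <= N -> kentucky2_upto N l = kentucky2 l.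
Proof.
elim: N l => [|N IHN] l; first by rewrite leqn0 => /eqP->.
rewrite leq_eqVlt => /predU1P[-> //|]; rewrite ltnS => leN.
rewrite -IHN //; case: N leN {IHN} => [|N] leN /=; first by move: leN; case: l.
by rewrite ltn_eqF.
Qed.

Lemma decomposable_eq a b N m : (forall l, l <= N -> a l = b l) ->
  decomposable a N m -> decomposable b N m.
Proof.
move=> eq_ab [ls /andP[/andP[lls /eqP sum_ls] ub_ls]]; exists ls.
rewrite /legal_decomp lls ub_ls andbT /= -sum_ls; apply/eqP.
by apply: eq_big_seq => l /(allP ub_ls)/eq_ab.
Qed.

Lemma kentucky2_1 : kentucky2 1 = 1. Proof. by []. Qed.

Lemma kentucky2S N : 1 <= N ->
  kentucky2 N.+1 = least_undecomposable kentucky2 N.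
Proof.
case: N => // N _; rewrite {1}/kentucky2.
have eqk l : l <= N.+1 -> kentucky2_upto N.+1 l = kentucky2 l.
  exact: kentucky2_uptoE.
transitivity (least_undecomposable (kentucky2_upto N.+1) N.+1).
  by rewrite [LHS]/= eqxx.
have equ : undecomposable (kentucky2_upto N.+1) N.+1
           =1 undecomposable kentucky2 N.+1.
  move=> m; congr (_ && ~~ _); apply: asbool_equiv_eq.
  by split; apply: decomposable_eq => l /eqk.
rewrite /least_undecomposable; case: ex_minnP => p Pp minp.
case: ex_minnP => q Pq minq; apply/eqP; rewrite eqn_leq.
by rewrite minp ?equ // minq -?equ.
Qed.

Lemma kentucky2_ltS N : 1 <= N -> kentucky2 N < kentucky2 N.+1.
Proof.
move=> N_gt0; rewrite kentucky2S // /least_undecomposable.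
case: ex_minnP => p /andP[p_gt0 /asboolPn p_nd] _.
rewrite ltnNge; apply/negP => le_p; apply: p_nd.
have [eq_p|ne_p] := eqVneq p (kentucky2 N).
  exists [:: N].
  by rewrite /legal_decomp /legal /= big_seq1 eq_p N_gt0 leqnn eqxx.
have lt_p : p < kentucky2 N by rewrite ltn_neqAle ne_p.
case: N N_gt0 {le_p ne_p} lt_p => // -[|N] _.
  by rewrite kentucky2_1 ltnS leqn0 => /eqP p0; rewrite p0 in p_gt0.
rewrite kentucky2S // /least_undecomposable.
case: ex_minnP => q _ minq lt_pq.
have: ~~ undecomposable kentucky2 N.+1 p.
  by apply: contraL lt_pq => /minq; rewrite leqNgt.
rewrite /undecomposable p_gt0 /= negbK => /asboolP[ls /andP[dls ub]].
by exists ls; rewrite dls /=; apply: sub_all ub => l; apply: leqW.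
Qed.

Lemma legal_decomp_ex m : exists ls, legal_decomp kentucky2 m ls.
Proof.
have ltk N : N < kentucky2 N.+1.
  by elim: N => // N IHN; apply: leq_ltn_trans IHN (kentucky2_ltS _).
case: m => [|m]; first by exists [::]; rewrite /legal_decomp big_nil.
have := ltk m.+1; rewrite kentucky2S // /least_undecomposable.
case: ex_minnP => q _ minq lt_mq.
have: ~~ undecomposable kentucky2 m.+1 m.+1.
  by apply: contraL lt_mq => /minq; rewrite leqNgt.
rewrite /undecomposable /= negbK => /asboolP[ls /andP[dls _]].
by exists ls.
Qed.

(* Legal decompositions are unique, so the choice below is immaterial. *)
Definition decomposition (m : nat) : seq nat := xchoose (legal_decomp_ex m).

Definition gaps (ls : seq nat) : seq nat :=
  if ls is l :: ls' then pairmap (fun x y => y - x) l ls' else [::].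

Definition gap_count (n g : nat) : nat :=
  \sum_(0 <= m < kentucky2 (2 * n + 1)) count_mem g (gaps (decomposition m)).

Definition gap_total (n : nat) : nat :=
  \sum_(0 <= m < kentucky2 (2 * n + 1)) size (gaps (decomposition m)).

(* For n <= 2 there are no gaps and the quotient 0 / 0 is 0. *)
Definition gap_fraction (R : realType) (g n : nat) : R :=
  ((gap_count n g)%:R / (gap_total n)%:R)%R.

Definition gap_limit (R : realType) (g : nat) : R :=
  limn (gap_fraction R g).

(* Main.v *)
(* The sequence is a_(2n) = 2^n, a_(2n+1) = J_n with J_(n+1) = J_n + 2 J_(n-1),
   and a_(l+1) - a_l = J_(bin l - 2).  Hence the decompositions of the integers
   below J_(n+1) are those of the integers below J_n together with those of the
   integers below J_(n-1), extended by 2n+1 or by 2n+2.  So the number X_n of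
   gaps of a given kind satisfies X_(n+1) = X_n + 2 X_(n-1) + Z_n, where Z_n is
   a sum of Jacobsthal numbers equal to z 2^n + O(1).  Then
   X_n = (z/3) n 2^n + O(2^n), and the limiting fraction is the ratio of the
   constants z for gaps equal to g and for all gaps (the latter is 4/3). *)
Require Import Defs.
From HB Require Import structures.
From mathcomp Require Import all_boot all_order all_algebra.
From mathcomp Require Import all_classical all_reals all_analysis.
From mathcomp Require Import zify ring lra.
Import Order.TTheory GRing.Theory Num.Theory.
Import numFieldNormedType.Exports.

Local Open Scope nat_scope.

(** * Jacobsthal numbers and the closed form *)

(* In terms of the usual Jacobsthal numbers 0, 1, 1, 3, 5, 11, ... this is
   shifted by two; [jac 0.-1 = 1] agrees with the extension to index [-1]. *)
Fixpoint jac (n : nat) : nat :=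
  match n with
  | 0 => 1
  | n'.+1 => match n' with 0 => 3 | n''.+1 => jac n' + 2 * jac n'' end
  end.

Lemma jacS n : jac n.+1 = jac n + 2 * jac n.-1.
Proof. by case: n. Qed.

Lemma jacD n : jac n + jac n.+1 = 2 ^ n.+2.
Proof.
elim: n => // n IH; rewrite [jac n.+2]jacS /= addnA addnn -mul2n -mulnDr.
by rewrite addnC IH -expnS.
Qed.

Definition kval (l : nat) : nat := if odd l then jac l./2 else 2 ^ l./2.

Lemma kval_odd n : kval (2 * n).+1 = jac n.
Proof.
rewrite /kval (_ : odd _ = true); last by lia.
by congr jac; lia.
Qed.

Lemma kval_even n : kval (2 * n) = 2 ^ n.
Proof.
rewrite /kval (_ : odd _ = false); last by lia.
by congr (2 ^ _); lia.
Qed.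

(** The increment is [kval] at [2 * (bin l - 2) + 1], the first index too close to precede [l]. For
    bins 1 and 2 truncation gives [jac 0 = 1]: nothing can precede [l]. *)
Lemma kvalS l : 0 < l -> kval l.+1 = kval l + jac (bin l - 2).
Proof.
move=> l_gt0; have [k [->|->]] : exists k, l = (2 * k).+1 \/ l = (2 * k).+2.
- by exists l.-1./2; lia.
- rewrite kval_odd (_ : (2 * k).+2 = 2 * k.+1); last by lia.
  rewrite kval_even (_ : bin _ - 2 = k.-1); last by rewrite /bin; lia.
  case: k => [//|k]; rewrite -jacD jacS /=; lia.
- rewrite (_ : (2 * k).+2 = 2 * k.+1); last by lia.
  rewrite kval_even kval_odd (_ : bin _ - 2 = k.-1); last by rewrite /bin; lia.
  case: k => [//|k]; rewrite -jacD [jac k.+2]jacS [jac k.+1]jacS /=; lia.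
Qed.

Lemma kval_leq l m : 0 < l -> l <= m -> kval l <= kval m.
Proof.
move=> l_gt0; elim: m => [|m IH]; first by lia.
rewrite leq_eqVlt => /predU1P[->//|lm]; apply: leq_trans (IH lm) _.
by rewrite kvalS ?leq_addr //; lia.
Qed.

(** * Existence and uniqueness of legal decompositions *)

Lemma legal_rcons ls l : 0 < l ->
  legal (rcons ls l) = legal ls && all (fun x => x <= 2 * (bin l - 2)) ls.
Proof.
move=> l_gt0; rewrite /legal.
have r_tr : transitive (fun i j => (i < j) && (bin i + 2 <= bin j)).
  by rewrite /bin => x y z; lia.
rewrite !(sorted_pairwise r_tr) pairwise_rcons all_rcons l_gt0 /=.
have [/allP pos_ls|//] := boolP (all _ _); rewrite /= andbC; congr (_ && _).
by apply: eq_in_all => x /pos_ls; rewrite /bin; lia.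
Qed.

Lemma legal_rconsW ls l : legal (rcons ls l) -> 0 < l.
Proof. by rewrite /legal all_rcons => /andP[/andP[]]. Qed.

Lemma sum_rcons (a : nat -> nat) ls l :
  \sum_(x <- rcons ls l) a x = \sum_(x <- ls) a x + a l.
Proof. by rewrite -cats1 big_cat big_seq1. Qed.

(** By induction, the terms before the last index [l] sum to less than the increment of [kval] at
    [l]. *)
Lemma legal_sum_lt ls N : legal ls -> all (fun x => x <= N) ls ->
  \sum_(x <- ls) kval x < kval N.+1.
Proof.
elim/last_ind: ls N => [|ls l IH] N.
  by move=> _ _; rewrite big_nil; apply: (@kval_leq 1).
move=> leg; have l_gt0 := legal_rconsW _ _ leg.
move: leg; rewrite legal_rcons // => /andP[leg ub].
rewrite all_rcons => /andP[lN _]; rewrite sum_rcons.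
apply: leq_trans (kval_leq l.+1 _ _ _) => //.
by rewrite kvalS // addnC ltn_add2l -kval_odd; apply: IH.
Qed.

(** The sum lies between [kval l] and [kval l.+1] for the last index [l], so it determines [l]; then
    the last terms cancel. *)
Lemma legal_sum_uniq s t : legal s -> legal t ->
  \sum_(x <- s) kval x = \sum_(x <- t) kval x -> s = t.
Proof.
have kval_gt0 l : 0 < l -> 0 < kval l by exact: (@kval_leq 1).
have last_bounds ls l : legal (rcons ls l) ->
    kval l <= \sum_(x <- rcons ls l) kval x < kval l.+1.
  move=> leg; rewrite {1}sum_rcons leq_addl legal_sum_lt //.
  have l_gt0 := legal_rconsW _ _ leg.
  move: leg; rewrite legal_rcons // all_rcons leqnn => /andP[_].
  by apply: sub_all => x; rewrite /bin; lia.
elim/last_ind: s t => [|s l IH] t; case/lastP: t => [//|t k].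
- move=> _ /[dup] /legal_rconsW /kval_gt0 k0 /last_bounds /[swap] <-.
  by rewrite big_nil; lia.
- move=> /[dup] /legal_rconsW /kval_gt0 k0 /last_bounds + _ e.
  by rewrite e big_nil; lia.
move=> ls lt e.
have k0 := legal_rconsW _ _ lt; have l0 := legal_rconsW _ _ ls.
have kl : k = l.
  move: (last_bounds _ _ ls) (last_bounds _ _ lt); rewrite e => /andP[a1 a2] /andP[b1 b2].
  apply/eqP; rewrite eqn_leq; apply/andP; split; rewrite leqNgt; apply/negP.
  - by move=> /(kval_leq l.+1 k isT); lia.
  - by move=> /(kval_leq k.+1 l isT); lia.
move: ls lt e; rewrite kl !legal_rcons // !sum_rcons.
by move=> /andP[ls _] /andP[lt _] /addIn /(IH _ ls lt) ->.
Qed.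

(** Greedy choice: subtract [kval N] when it fits; the remainder is small enough to use only indices
    compatible with [N]. *)
Lemma legal_sum_ex N m : m < kval N.+1 ->
  exists ls, [/\ legal ls, all (fun x => x <= N) ls
               & \sum_(x <- ls) kval x = m].
Proof.
elim/ltn_ind: N m => -[|N] IH m.
  by rewrite ltnS leqn0 => /eqP ->; exists [::]; rewrite big_nil.
have [mN _|Nm mN] := ltnP m (kval N.+1).
  have [ls [l1 l2 l3]] := IH N (ltnSn N) m mN; exists ls; split=> //.
  by apply: sub_all l2 => x; lia.
have [||ls [l1 l2 l3]] := IH (2 * (bin N.+1 - 2)) _ (m - kval N.+1).
- by rewrite /bin; lia.
- by move: mN; rewrite kval_odd kvalS //; lia.
exists (rcons ls N.+1); split.
- by rewrite legal_rcons // l1.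
- rewrite all_rcons leqnn /=; apply: sub_all l2 => x; rewrite /bin; lia.
- by rewrite sum_rcons l3 subnK.
Qed.

Lemma kentucky2E N : 0 < N -> kentucky2 N = kval N.
Proof.
elim/ltn_ind: N => -[//|[//|N]] IH _; rewrite kentucky2S //.
(* The decomposable integers form an initial segment, whose end is the least undecomposable one. *)
have dec m : decomposable kentucky2 N.+1 m <-> m < kval N.+2.
  have sumE ls : legal ls -> all (fun l => l <= N.+1) ls ->
      \sum_(l <- ls) kentucky2 l = \sum_(l <- ls) kval l.
    move=> /andP[/allP pos _] /allP ub; apply: eq_big_seq => l lls.
    by apply: IH; [apply: ub | apply: pos].
  split=> [[ls /andP[/andP[leg /eqP <-] ub]]|/legal_sum_ex[ls [leg ub <-]]].
    by rewrite sumE // legal_sum_lt.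
  by exists ls; rewrite /legal_decomp leg ub sumE ?eqxx.
rewrite /least_undecomposable; case: ex_minnP => q /andP[q0 /asboolPn qn] minq.
apply/eqP; rewrite eqn_leq; apply/andP; split; last first.
  by rewrite leqNgt; apply/negP => /dec.
apply: minq; apply/andP; split; first exact: (@kval_leq 1).
by apply/asboolPn => /dec; rewrite ltnn.
Qed.

Lemma decompositionP m :
  legal (decomposition m) /\ \sum_(l <- decomposition m) kval l = m.
Proof.
have /andP[leg /eqP s] := xchooseP (legal_decomp_ex m).
split=> //; rewrite -[RHS]s; apply: eq_big_seq => l.
by case/andP: leg => /allP pos _ /pos /kentucky2E.
Qed.

Lemma decomposition_ub N m : m < kval N.+1 ->
  all (fun l => l <= N) (decomposition m).
Proof.
move=> /legal_sum_ex[ls [leg ub s]]; have [leg' s'] := decompositionP m.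
by rewrite (legal_sum_uniq _ _ leg' leg) // s s'.
Qed.

Lemma decomposition_rcons l m : 0 < l -> m < jac (bin l - 2) ->
  decomposition (kval l + m) = rcons (decomposition m) l.
Proof.
move=> l0 ml; have [leg s] := decompositionP m.
have [leg' s'] := decompositionP (kval l + m).
apply: legal_sum_uniq => //; last by rewrite s' sum_rcons s addnC.
by rewrite legal_rcons // leg decomposition_ub // kval_odd.
Qed.

Lemma decomposition0 : decomposition 0 = [::].
Proof.
have [leg s] := decompositionP 0.
by apply: legal_sum_uniq; rewrite // s big_nil.
Qed.

(** * The recurrence for gap counts *)

Lemma sum_nat_shift (a b : nat) (G : nat -> nat) :
  \sum_(0 <= m < a + b) G m =
  \sum_(0 <= m < a) G m + \sum_(0 <= m < b) G (a + m).
Proof.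
rewrite (@big_cat_nat _ _ _ a) //= ?leq_addr //; congr (_ + _).
by rewrite -{1}[a]add0n big_addn addKn; apply: eq_bigr => i _; rewrite addnC.
Qed.

Lemma sum_decompositionS (F : seq nat -> nat) n :
  \sum_(0 <= m < jac n.+1) F (decomposition m) =
    \sum_(0 <= m < jac n) F (decomposition m)
    + \sum_(0 <= m < jac n.-1)
        (F (rcons (decomposition m) (2 * n).+1)
         + F (rcons (decomposition m) (2 * n).+2)).
Proof.
have b1 : bin (2 * n).+1 - 2 = n.-1 by rewrite /bin; lia.
have b2 : bin (2 * n).+2 - 2 = n.-1 by rewrite /bin; lia.
have k1 := kvalS (2 * n).+1 isT; have k2 := kvalS (2 * n).+2 isT.
rewrite b1 kval_odd in k1; rewrite b2 in k2.
(* The two upper blocks start at [kval (2 * n).+1] and [kval (2 * n).+2], their largest summands. *)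
have -> : jac n.+1 = jac n + jac n.-1 + jac n.-1 by rewrite jacS; lia.
rewrite sum_nat_shift -k1 {1}k1 sum_nat_shift -addnA -big_split /=.
congr (_ + _); apply: eq_big_nat => m mn; rewrite -[in X in X + _]kval_odd.
by rewrite !decomposition_rcons ?b1 ?b2.
Qed.

Definition gap_sum (p : pred nat) n :=
  \sum_(0 <= m < jac n) count p (gaps (decomposition m)).

(** The size test keeps the default 0 of [last] from producing a spurious gap [t]. *)
Definition last_gap (p : pred nat) (t : nat) (ls : seq nat) : nat :=
  (0 < size ls) && p (t - last 0 ls).

Lemma count_gaps_rcons p ls t :
  count p (gaps (rcons ls t)) = count p (gaps ls) + last_gap p t ls.
Proof.
case: ls => [//|x s]; rewrite /last_gap /=.
elim: s x => [|y s IH] x /=; first by rewrite addn0 add0n.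
by rewrite IH addnA.
Qed.

(** Group by the last index: each of [2i + 1] and [2i + 2] ends [jac i.-1] decompositions. *)
Lemma sum_last_gap p t n :
  \sum_(0 <= m < jac n) last_gap p t (decomposition m) =
  \sum_(i < n) jac i.-1 * (p (t - (2 * i).+1) + p (t - (2 * i).+2)).
Proof.
elim: n => [|n IH].
  by rewrite big_ord0 big_nat1 decomposition0.
rewrite sum_decompositionS IH big_ord_recr /=; congr (_ + _).
rewrite -[jac n.-1 in RHS]subn0 -sum_nat_const_nat; apply: eq_bigr => m _.
by rewrite /last_gap !size_rcons !last_rcons.
Qed.

(* The number of new gaps created when bin [n.+1] is filled; a gap between bins
   at distance [k = n - i] is [2k] in two ways and [2k - 1], [2k + 1] in one. *)
Definition gap_source (p : pred nat) n : nat :=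
  \sum_(i < n.-1) jac i.-1 *
    (2 * p (2 * (n - i)) + p (2 * (n - i)).-1 + p (2 * (n - i)).+1).

Lemma gap_sumS p n :
  gap_sum p n.+1 = gap_sum p n + 2 * gap_sum p n.-1 + gap_source p n.
Proof.
rewrite /gap_sum (sum_decompositionS (fun ls => count p (gaps ls))) -addnA.
congr (_ + _).
under eq_bigr do rewrite !count_gaps_rcons addnACA addnn -mul2n.
rewrite big_split -big_distrr; congr (_ + _).
rewrite big_split !sum_last_gap -big_split; apply: eq_bigr => i _ /=.
rewrite -mulnDr; congr (_ * _).
have -> : (2 * n).+1 - (2 * i).+1 = 2 * (n - i) by lia.
have -> : (2 * n).+2 - (2 * i).+2 = 2 * (n - i) by lia.
have -> : (2 * n).+1 - (2 * i).+2 = (2 * (n - i)).-1 by lia.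
have -> : (2 * n).+2 - (2 * i).+1 = (2 * (n - i)).+1.
  by have := ltn_ord i; lia.
lia.
Qed.

(** Only [i = n - k] survives, and it lies in the range exactly when [2 <= k <= n]. *)
Lemma sum_jac_pick k n (q : nat -> nat) :
  (forall i, i < n.-1 -> q i = (n - i == k)) ->
  \sum_(i < n.-1) jac i.-1 * q i = if 2 <= k <= n then jac (n - k).-1 else 0.
Proof.
move=> qE; under eq_bigr do rewrite qE //.
case: ifP => [/andP[k2 kn]|kn].
  have lt : n - k < n.-1 by lia.
  rewrite (bigD1 (Ordinal lt)) //= big1 ?addn0 => [|i ni]; last first.
    have /eqP ne : i != n - k :> nat by [].
    rewrite (_ : (n - i == k) = false) ?muln0 //.
    by have := ltn_ord i; lia.
  by rewrite subKn // eqxx muln1.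
rewrite big1 // => i _; rewrite (_ : (n - i == k) = false) ?muln0 //.
by have := ltn_ord i; lia.
Qed.

Lemma gap_source_pred1_double j n :
  gap_source (pred1 (2 * j)) n =
  2 * (if 2 <= j <= n then jac (n - j).-1 else 0).
Proof.
rewrite -(sum_jac_pick j n (fun i => 2 * (n - i) == 2 * j)) => [|i]; last by lia.
rewrite big_distrr; apply: eq_bigr => i _ /=; rewrite mulnCA.
by congr (_ * _); have := ltn_ord i; lia.
Qed.

(** An odd gap [2j + 1] arises from bins at distance [j] or [j + 1]. *)
Lemma gap_source_pred1_doubleS j n :
  gap_source (pred1 (2 * j).+1) n =
  (if 2 <= j <= n then jac (n - j).-1 else 0)
  + (if 2 <= j.+1 <= n then jac (n - j.+1).-1 else 0).
Proof.
rewrite -(sum_jac_pick j n (fun i => (2 * (n - i)).+1 == (2 * j).+1)) => [|i];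
  last by lia.
rewrite -(sum_jac_pick j.+1 n (fun i => (2 * (n - i)).-1 == (2 * j).+1)) => [|i];
  last by lia.
rewrite -big_split; apply: eq_bigr => i _ /=; rewrite -mulnDr.
by congr (_ * _); lia.
Qed.

Lemma gap_source_predT n :
  gap_source predT n = 4 * \sum_(i < n.-1) jac i.-1.
Proof.
by rewrite /gap_source big_distrr; apply: eq_bigr => i _; rewrite mulnC.
Qed.

(** * Asymptotics of the counts *)

Local Open Scope classical_set_scope.
Local Open Scope ring_scope.

(** By [jacD] the error only changes sign from [n] to [n + 1]. *)
Lemma jac_approx (R : realFieldType) n :
  `|(jac n)%:R - 4 / 3 * 2 ^+ n| <= 1 / 3 :> R.
Proof.
elim: n => [|n]; first by rewrite expr0 ler_norml /=; lra.
have := congr1 (fun k : nat => k%:R : R) (jacD n).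
rewrite natrD natrX !exprS !ler_norml => e /andP[h1 h2]; apply/andP; split; lra.
Qed.

(* The limit of [jac (n - k).-1 / 2 ^ n]; bins at distance less than 2 cannot
   both be used. *)
Definition binlim (R : realFieldType) k : R :=
  if (2 <= k)%N then 2 / 3 * 2 ^- k else 0.

Lemma bin_approx (R : realFieldType) k : exists C : R, forall n,
  `|(if (2 <= k <= n)%N then jac (n - k).-1 else 0%N)%:R - binlim R k * 2 ^+ n|
   <= C.
Proof.
rewrite /binlim; case: (leqP 2 k) => k2 /=; last first.
  by exists 0 => n; rewrite mul0r subr0 normr0.
exists 1 => n; have p0 m : 0 < 2 ^+ m :> R by rewrite exprn_gt0.
have [kn|nk] := leqP k n; last first.
  rewrite sub0r normrN ger0_norm; last first.
    by rewrite !mulr_ge0 ?invr_ge0 ?ltW.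
  rewrite mulrAC ler_pdivrMr //.
  have : 2 ^+ n <= 2 ^+ k :> R by rewrite ler_weXn2l ?ler1n // ltnW.
  by have := p0 k; lra.
have -> : 2 / 3 * 2 ^- k * 2 ^+ n = 2 / 3 * 2 ^+ (n - k) :> R.
  by rewrite expfB_cond ?pnatr_eq0 // mulrA mulrAC.
(* At [k = n] the predecessor is truncated: [jac 0 = 1] is compared with [2 / 3]. *)
case: (n - k)%N => [|m]; first by rewrite expr0 ler_norml /=; lra.
rewrite exprS (_ : 2 / 3 * (2 * 2 ^+ m) = 4 / 3 * 2 ^+ m); last by lra.
by apply: le_trans (jac_approx _ _) _; lra.
Qed.

Lemma total_approx (R : realFieldType) n :
  `|(gap_source predT n)%:R - 4 / 3 * 2 ^+ n| <= 8 / 3 :> R.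
Proof.
rewrite gap_source_predT.
suff H : forall n, `|(4 * \sum_(i < n.+1) jac i.-1)%:R - 4 / 3 * 2 ^+ n.+2|
    <= 8 / 3 :> R.
  case: n => [|[|n]]; [by rewrite big_ord0 ler_norml ?expr0 ?expr1 /=; lra..|].
  exact: H.
(* Two consecutive terms add up to a power of two by [jacD], so the error has period 2; [8 / 3] is
   the larger initial error. *)
move=> {}n; elim/ltn_ind: n => -[|[|n]] IH.
- by rewrite big_ord1 muln1 ler_norml; lra.
- by rewrite big_ord_recr big_ord1 (_ : (4 * _)%N = 8%N) // ler_norml; lra.
rewrite 2!big_ord_recr /= -addnA jacD; have := IH n (leqnSn _).
rewrite !natrM natrD natrX !exprS !ler_norml => /andP[h1 h2].
by apply/andP; split; lra.
Qed.

(* The exact solution [z/3 n 2^n] of the recurrence with source [z 2^n] absorbs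
   the growth; a bounded perturbation of the source costs only [O(2^n)]. *)
Lemma gap_sum_approx (R : realFieldType) p (z C : R) :
  (forall n, `|(gap_source p n)%:R - z * 2 ^+ n| <= C) ->
  exists K : R, forall n,
    `|(gap_sum p n)%:R - z / 3 * n%:R * 2 ^+ n| <= K * 2 ^+ n.
Proof.
move=> hZ; have C0 : 0 <= C by apply: le_trans (hZ 0%N).
pose E n : R := (gap_sum p n)%:R - z / 3 * n%:R * 2 ^+ n.
(* The offset [- C / 2] in the strengthened bound reproduces itself:
   [- C / 2 - 2 * (C / 2) + C = - C / 2]. *)
pose K := C / 2 + `|E 1%N|; exists K.
suff H n : `|E n| <= K * 2 ^+ n - C / 2.
  by move=> n; apply: le_trans (H n) _; lra.
elim/ltn_ind: n => -[|[|n]] IH.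
- rewrite /E /gap_sum big_nat1 decomposition0 mulr0 mul0r subr0 normr0 expr0 /K.
  by have := normr_ge0 (E 1%N); lra.
- by rewrite expr1 /K; have := normr_ge0 (E 1%N); lra.
have ES : E n.+2 = E n.+1 + 2 * E n + ((gap_source p n.+1)%:R - z * 2 ^+ n.+1).
  rewrite /E gap_sumS /= 2!natrD natrM -[n.+2%:R]natr1 -[n.+1%:R]natr1 !exprS.
  by field.
rewrite ES; have := IH n (leqnSn _); have := IH n.+1 (ltnSn _); have := hZ n.+1.
rewrite !exprS !ler_norml => /andP[a1 a2] /andP[b1 b2] /andP[c1 c2].
by apply/andP; split; lra.
Qed.

Lemma gap_sum_cvg (R : realType) p (z C : R) :
  (forall n, `|(gap_source p n)%:R - z * 2 ^+ n| <= C) ->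
  (fun n => (gap_sum p n.+1)%:R / (n.+1%:R * 2 ^+ n.+1) : R) @ \oo --> z / 3.
Proof.
move=> /gap_sum_approx[K hK].
have Kharm : (fun n => K * harmonic n) @ \oo --> (0 : R).
  by rewrite -[X in _ --> X](mulr0 K); apply: cvgMl_tmp; apply: cvg_harmonic.
apply: (@squeeze_cvgr _ _ _ _ (fun n => z / 3 - K * harmonic n)
                              (fun n => z / 3 + K * harmonic n)).
- near=> n; have n0 : 0 < n.+1%:R :> R by rewrite ltr0n.
  have p0 : 0 < 2 ^+ n.+1 :> R by rewrite exprn_gt0.
  have np0 := mulr_gt0 n0 p0.
  rewrite /harmonic /= -ler_distl -(ler_pM2r np0) -{2}(gtr0_norm np0) -normrM.
  rewrite mulrBl divfK ?gt_eqF // !mulrA mulfVK ?gt_eqF //.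
- by rewrite -[X in _ --> X]subr0; apply: cvgB => //; apply: cvg_cst.
- by rewrite -[X in _ --> X]addr0; apply: cvgD => //; apply: cvg_cst.
Unshelve. all: by end_near. Qed.

(** * Limits of the gap fractions *)

Lemma gap_fraction_cvg (R : realType) (g : nat) (z C : R) :
  (forall n, `|(gap_source (pred1 g) n)%:R - z * 2 ^+ n| <= C) ->
  gap_fraction R g @ \oo --> 3 / 4 * z.
Proof.
move=> /gap_sum_cvg Hg; have HT := gap_sum_cvg R _ _ _ (total_approx R).
(* Numerator and denominator are both normalised by [n 2^n], which cancels; [4 / 3] comes from
   [total_approx]. *)
have nz : 4 / 3 / 3 != 0 :> R by apply/eqP; lra.
rewrite -cvg_shiftS (_ : 3 / 4 * z = z / 3 / (4 / 3 / 3)); last by field.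
apply: cvg_trans (cvgM Hg (cvgV nz HT)); apply: near_eq_cvg; near=> n.
rewrite /= /gap_fraction /gap_count /gap_total kentucky2E ?addn1 // kval_odd.
rewrite -/(gap_sum (pred1 g) n.+1) /=.
under eq_bigr do rewrite -count_predT.
by rewrite -/(gap_sum predT n.+1) /= invf_div mulrA divfK //.
Unshelve. all: by end_near. Qed.

Lemma gap_fraction_double_cvg (R : realType) j :
  gap_fraction R (2 * j) @ \oo --> 3 / 2 * binlim R j.
Proof.
have [C hC] := bin_approx R j.
rewrite (_ : 3 / 2 * _ = 3 / 4 * (2 * binlim R j)); last by field.
apply: (@gap_fraction_cvg _ _ _ (2 * C)) => n.
rewrite gap_source_pred1_double natrM -mulrA -mulrBr normrM ger0_norm //.
by rewrite ler_pM2l.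
Qed.

Lemma gap_fraction_doubleS_cvg (R : realType) j :
  gap_fraction R (2 * j).+1 @ \oo --> 3 / 4 * (binlim R j + binlim R j.+1).
Proof.
have [C hC] := bin_approx R j; have [D hD] := bin_approx R j.+1.
apply: (@gap_fraction_cvg _ _ _ (C + D)) => n.
rewrite gap_source_pred1_doubleS natrD mulrDl opprD addrACA.
exact: le_trans (ler_normD _ _) (lerD (hC n) (hD n)).
Qed.

Theorem theorem1p4 (R : realType) :
  (forall g : nat, cvgn (gap_fraction R g)) /\
  [/\ gap_limit R 0 = 0, gap_limit R 1 = 0, gap_limit R 2 = 0,
      gap_limit R 3 = 1 / 8 &
      forall g : nat, (4 <= g)%N -> forall j : nat,
        (g = (2 * j)%N -> gap_limit R g = 2 ^- j) /\
        (g = (2 * j + 1)%N -> gap_limit R g = 3 / 4 * 2 ^- j)].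
Proof.
have L0 j : gap_limit R (2 * j) = 3 / 2 * binlim R j.
  by apply: cvg_lim => //; apply: gap_fraction_double_cvg.
have L1 j : gap_limit R (2 * j).+1 = 3 / 4 * (binlim R j + binlim R j.+1).
  by apply: cvg_lim => //; apply: gap_fraction_doubleS_cvg.
split=> [g|].
  have [j [->|->]] : exists j, g = (2 * j)%N \/ g = (2 * j).+1.
  - by exists g./2; lia.
  - by apply/cvg_ex; eexists; apply: gap_fraction_double_cvg.
  - by apply/cvg_ex; eexists; apply: gap_fraction_doubleS_cvg.
split.
- by rewrite (L0 0%N) /binlim mulr0.
- by rewrite (L1 0%N) /binlim addr0 mulr0.
- by rewrite (L0 1%N) /binlim mulr0.
(* Since [binlim R 1 = 0], only bins at distance 2 contribute, so gap 3 escapes the general odd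
   formula. *)
- by rewrite (L1 1%N) /binlim /=; field.
move=> g g4 j; have p0 : 2 ^+ j != 0 :> R by rewrite expf_neq0 ?pnatr_eq0.
split=> gE; have j2 : (2 <= j)%N by lia.
- by rewrite gE L0 /binlim j2; field.
- by rewrite gE addn1 L1 /binlim j2 (leqW j2) exprS; field.
Qed.
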